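(* Let $(\mathbf K_\alpha:\alpha\ge m_0)$ be a complete system of varieties definable by a schema, let $\alpha$ be an infinite ordinal and let $\mathfrak A\in\mathbf K_\alpha$. Suppose that for every finite injective map $\rho$ into $\alpha$ and all $x,y\in A$ with $x\ne y$ there are a function $h$ and $k<\alpha$ such that $h$ is an endomorphism of $\mathfrak{Rd}^\rho\mathfrak A$, $k\in\alpha\setminus Rng(\rho)$, $c_k\circ h=h$ and $h(x)\ne h(y)$. Then $\mathfrak A\in \mathbf{Up}\,S\,\mathfrak{Nr}_\alpha\mathbf K_{\alpha+\omega}$.
   Context: Let $2\le m_0<\omega$. A finite $m_0$-type schema is $t=(T,\delta,\rho,c)$ where $T$ is a set, $\delta,\rho:T\to\omega$, $c\in T$, $\delta c=\rho c=1$, and $\delta f\le m_0$ for all $f\in T$. It defines for each ordinal $n$ a similarity type $t_n$ with one operation symbol $f_{k_0,\dots,k_{\delta f-1}}$ of arity $\rho f$ for each $f\in T$, $k\in{}^{\delta f}n$. The algebras considered are Boolean algebras with operators (Boolean operations being symbols with $\delta=0$); the $c_i$ are called cylindrifications. For an injection $\eta:\beta\to n$ and an equation $e$ in the language of $t_\beta$, $\eta^+(e)$ is obtained by replacing each index $i$ in $e$ by $\eta(i)$. A complete system of varieties definable by a schema is a system $(\mathbf K_n:n\ge m_0)$, $\mathbf K_n$ a class of algebras of type $t_n$ for each ordinal $n\geq m_0$, for which there are sets of equations $\Sigma_n$ with $\mathbf K_n=\mathrm{Mod}(\Sigma_n)$; for $n\le l<\omega$, $e\in\Sigma_n$ and injection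 $\rho:n\to l$, $\rho^+e\in\Sigma_l$; $\Sigma_\omega=\bigcup_{m_0\le n<\omega}\Sigma_n$; and for $\alpha\ge\omega$, $\mathbf K_\alpha$ is axiomatized by $\{\rho^+e:e\in\Sigma_\omega,\ \rho:\omega\to\alpha\text{ injective}\}$. For $\mathfrak A$ of type $t_\alpha$ and an injection $\rho:\gamma\to\alpha$, $\mathfrak{Rd}^\rho\mathfrak A$ is the algebra of type $t_\gamma$ on the same universe whose operation $f_{k_0,\dots,k_{\delta f-1}}$ is $f^{\mathfrak A}_{\rho(k_0),\dots,\rho(k_{\delta f-1})}$. $\mathfrak{Rd}_\alpha\mathfrak B$ is $\mathfrak{Rd}^\rho\mathfrak B$ for $\rho$ the inclusion. For $\mathfrak B\in\mathbf K_\beta$, $\alpha<\beta$, $\Delta x=\{i<\beta:c_ix\ne x\}$; it is assumed that $\{x:\Delta x\subseteq\alpha\}$ is closed under the operations with indices in $\alpha$, and $\mathfrak{Nr}_\alpha\mathfrak B$ is the subalgebra of $\mathfrak{Rd}_\alpha\mathfrak B$ with that universe. $\mathfrak{Nr}_\alpha\mathbf L=\{\mathfrak{Nr}_\alpha\mathfrak B:\mathfrak B\in\mathbf L\}$; $S$ and $\mathbf{Up}$ denote closure under (isomorphic copies of) subalgebras and ultraproducts. A finite injective map into $\alpha$ is an injection $\rho:k\to\alpha$ with $k<\omega$. *)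

(* Defs.v *)
From mathcomp Require Import all_boot.
From mathcomp Require Import boolp classical_sets wochoice filter.

Set Implicit Arguments.
Unset Strict Implicit.
Unset Printing Implicit Defensive.

Local Open Scope classical_set_scope.

(* Ordinals are represented by well-ordered types, [wo_le] being the
   reflexive order.  The inclusion of an ordinal [a] into an ordinal [b >= a]
   is then the (unique) embedding of [a] onto an initial segment of [b]. *)
Record wotype := WOType {
  wo_sort :> Type;
  wo_le : rel wo_sort;
  wo_leP : well_order wo_le
}.

Record segment (a b : wotype) := Segment {
  seg_fun :> a -> b;
  seg_mono : {mono seg_fun : x y / @wo_le a x y >-> @wo_le b x y};
  seg_down : forall x y, @wo_le b y (seg_fun x) -> exists z, y = seg_fun z
}.

Definition proper_segment (a b : wotype) (s : segment a b) : Prop :=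
  exists y, ~ range s y.

Definition ord_le (a b : wotype) : Prop := inhabited (segment a b).

Definition ord_lt (a b : wotype) : Prop :=
  exists s : segment a b, proper_segment s.

Lemma nat_well_order : well_order leq.
Proof.
move=> A [n An]; have exA : exists n, A n by exists n.
exists (ex_minn exA); case: ex_minnP => m Am mP; split.
  by split=> [|x Ax]; [exact: Am | exact: mP].
move=> p [Ap pP]; apply/eqP; rewrite eqn_leq.
by rewrite (mP _ Ap) (pP _ Am).
Qed.

Definition omega : wotype := WOType nat_well_order.

Lemma fin_well_order k : well_order (fun i j : 'I_k => i <= j).
Proof.
move=> A [i0 Ai0]; case: (arg_minnP (fun i : 'I_k => i : nat) Ai0) => i Ai iP.
exists i; split; first by split=> // j Aj; exact: iP.
move=> p [Ap pP]; apply/val_inj/eqP; rewrite eqn_leq.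
by rewrite (iP _ Ap) (pP _ Ai).
Qed.

Definition fin_ord (k : nat) : wotype := WOType (@fin_well_order k).

Definition add_le (a b : wotype) : rel (a + b) := fun x y =>
  match x, y with
  | inl x, inl y => wo_le x y
  | inl _, inr _ => true
  | inr _, inl _ => false
  | inr x, inr y => wo_le x y
  end.

Lemma add_well_order (a b : wotype) : well_order (@add_le a b).
Proof.
move=> A [u Au].
have [[x Ax]|noA] := pselect (exists x, A (inl x)).
  have [|z [[Az zP] zU]] := @wo_leP a (fun x => A (inl x)); first by exists x.
  exists (inl z); split.
    by split=> // -[y|y] Ay //=; exact: zP.
  case=> [y|y] [Ay yP]; last by have := yP _ Ax.
  by congr inl; apply: zU; split=> // w Aw; have /= := yP _ Aw.
have [|z [[Az zP] zU]] := @wo_leP b (fun x => A (inr x)).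
  by case: u Au => x Ax; [case: noA; exists x | exists x].
exists (inr z); split.
  by split=> // -[y|y] Ay //=; [case: noA; exists y | exact: zP].
case=> [y|y] [Ay yP]; first by case: noA; exists y.
by congr inr; apply: zU; split=> // w Aw; have /= := yP _ Aw.
Qed.

Definition ord_add (a b : wotype) : wotype := WOType (@add_well_order a b).

Lemma add_seg_mono (a b : wotype) :
  {mono (inl : a -> ord_add a b) : x y / wo_le x y >-> wo_le x y}.
Proof. by []. Qed.

Lemma add_seg_down (a b : wotype) (x : a) (y : ord_add a b) :
  wo_le y (inl x : ord_add a b) -> exists z, y = inl z.
Proof. by case: y => // y _; exists y. Qed.

Definition add_seg (a b : wotype) : segment a (ord_add a b) :=
  Segment (@add_seg_mono a b) (@add_seg_down a b).

Inductive bool_symbol := Join | Meet | Compl | Zero | One.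

Definition bool_arity (b : bool_symbol) : nat :=
  match b with Join | Meet => 2 | Compl => 1 | Zero | One => 0 end.

Record schema (m0 : nat) := Schema {
  symbol :> Type;
  delta : symbol -> nat;
  rho : symbol -> nat;
  cyl_symbol : symbol;
  delta_cyl : delta cyl_symbol = 1;
  rho_cyl : rho cyl_symbol = 1;
  delta_le : forall f, delta f <= m0;
  bsym : bool_symbol -> symbol;
  bsym_inj : injective bsym;
  delta_bsym : forall b, delta (bsym b) = 0;
  rho_bsym : forall b, rho (bsym b) = bool_arity b
}.

Record algebra m0 (t : schema m0) (I : Type) := Algebra {
  carrier :> Type;
  op : forall f : t, ('I_(delta f) -> I) -> ('I_(rho f) -> carrier) -> carrier
}.
Arguments op {m0 t I} _ _ _ _.

Inductive term m0 (t : schema m0) (I : Type) : Type :=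
  | Var of nat
  | App (f : t) of 'I_(delta f) -> I & 'I_(rho f) -> term t I.
Arguments Var {m0 t I} _.

Definition equation m0 (t : schema m0) (I : Type) : Type :=
  (term t I * term t I)%type.

Fixpoint eval m0 (t : schema m0) I (A : algebra t I) (v : nat -> A)
    (s : term t I) : A :=
  match s with
  | Var n => v n
  | App f k args => op A f k (fun i => eval v (args i))
  end.

Definition holds m0 (t : schema m0) I (A : algebra t I) (e : equation t I) :=
  forall v : nat -> A, eval v e.1 = eval v e.2.

(* Classes of algebras are plain predicates rather than [set]s: [set]s share
   their universe with the carriers of [eq_quot] quotients, hence with those
   of algebras. *)
Definition alg_class m0 (t : schema m0) (I : Type) := algebra t I -> Prop.

Definition Mod m0 (t : schema m0) I (S : set (equation t I)) :
  alg_class t I := fun A => forall e, S e -> holds A e.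

Fixpoint term_map m0 (t : schema m0) I J (r : I -> J) (s : term t I) :
    term t J :=
  match s with
  | Var n => Var n
  | App f k args => App (r \o k) (fun i => term_map r (args i))
  end.

Definition equation_map m0 (t : schema m0) I J (r : I -> J)
  (e : equation t I) : equation t J := (term_map r e.1, term_map r e.2).

Definition cyl m0 (t : schema m0) I (A : algebra t I) (i : I) (x : A) : A :=
  op A (cyl_symbol t) (fun=> i) (fun=> x).

Lemma no_index n (I : Type) : n = 0 -> 'I_n -> I.
Proof. by move=> -> []. Qed.

(* Indexless operations: their tuple of indices is the empty one. *)
Definition bool_op m0 (t : schema m0) I (A : algebra t I) (b : bool_symbol) :=
  op A (bsym t b) (@no_index _ I (delta_bsym t b)).
Arguments bool_op {m0 t I} A b _.

Definition join m0 (t : schema m0) I (A : algebra t I) (x y : A) : A :=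
  bool_op A Join (fun i => if i == 0 :> nat then x else y).
Definition meet m0 (t : schema m0) I (A : algebra t I) (x y : A) : A :=
  bool_op A Meet (fun i => if i == 0 :> nat then x else y).
Definition compl m0 (t : schema m0) I (A : algebra t I) (x : A) : A :=
  bool_op A Compl (fun=> x).
Definition zero m0 (t : schema m0) I (A : algebra t I) : A :=
  bool_op A Zero (@no_index _ A (rho_bsym t Zero)).
Definition one m0 (t : schema m0) I (A : algebra t I) : A :=
  bool_op A One (@no_index _ A (rho_bsym t One)).

Record is_boolean m0 (t : schema m0) I (A : algebra t I) : Prop := IsBoolean {
  joinA : associative (@join _ _ _ A);
  joinC : commutative (@join _ _ _ A);
  meetA : associative (@meet _ _ _ A);
  meetC : commutative (@meet _ _ _ A);
  joinKI : forall x y : A, join x (meet x y) = x;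
  meetKU : forall x y : A, meet x (join x y) = x;
  meetUl : left_distributive (@meet _ _ _ A) (@join _ _ _ A);
  joinIl : left_distributive (@join _ _ _ A) (@meet _ _ _ A);
  join0x : left_id (zero A) (@join _ _ _ A);
  meet1x : left_id (one A) (@meet _ _ _ A);
  joinxC : right_inverse (one A) (@compl _ _ _ A) (@join _ _ _ A);
  meetxC : right_inverse (zero A) (@compl _ _ _ A) (@meet _ _ _ A)
}.

(* Operators are additive in each argument; normality is not required. *)
Definition is_bao m0 (t : schema m0) I (A : algebra t I) : Prop :=
  is_boolean A /\
  forall f : t, ~ range (bsym t) f ->
  forall (k : 'I_(delta f) -> I) (args : 'I_(rho f) -> A) (j : 'I_(rho f))
         (x y : A),
    op A f k [eta args with j |-> join x y] =
    join (op A f k [eta args with j |-> x]) (op A f k [eta args with j |-> y]).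

Definition complete_system m0 (t : schema m0)
    (K : forall n : wotype, alg_class t n) : Prop :=
  (forall n, ord_le (fin_ord m0) n -> forall A, K n A -> is_bao A) /\
  exists Sigma : forall n : wotype, set (equation t n),
  [/\ forall n, ord_le (fin_ord m0) n ->
        forall A, K n A <-> Mod (Sigma n) A,
      forall n l, ord_le (fin_ord m0) n -> ord_le n l -> ord_lt l omega ->
        forall (e : equation t n) (r : n -> l), Sigma n e -> injective r ->
        Sigma l (equation_map r e),
      Sigma omega = [set e | exists (n : wotype) (s : segment n omega),
        [/\ ord_le (fin_ord m0) n, proper_segment s &
            exists2 e0, Sigma n e0 & e = equation_map s e0]]
    & forall a, ord_le omega a ->
        forall A, K a A <->
          Mod [set e | exists (e0 : equation t omega) (r : omega -> a),
                 [/\ Sigma omega e0, injective r & e = equation_map r e0]] A].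

Definition is_hom m0 (t : schema m0) I (A B : algebra t I) (h : A -> B) :=
  forall (f : t) (k : 'I_(delta f) -> I) (args : 'I_(rho f) -> A),
    h (op A f k args) = op B f k (h \o args).

Definition isomorphic m0 (t : schema m0) I (A B : algebra t I) : Prop :=
  exists2 h : A -> B, is_hom h & bijective h.

Definition op_closed m0 (t : schema m0) I (A : algebra t I) (X : set A) :=
  forall (f : t) (k : 'I_(delta f) -> I) (args : 'I_(rho f) -> A),
    (forall i, X (args i)) -> X (op A f k args).

Definition subalg m0 (t : schema m0) I (A : algebra t I) (X : set A)
    (XP : op_closed X) : algebra t I :=
  @Algebra m0 t I {x : A | X x} (fun f k args =>
    exist X (op A f k (fun i => sval (args i)))
      (XP f k _ (fun i => svalP (args i)))).

Definition S_class m0 (t : schema m0) I (L : alg_class t I) :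
    alg_class t I := fun A =>
  exists (B : algebra t I) (X : set B) (XP : op_closed X),
     L B /\ isomorphic A (subalg XP).

Section Ultraproduct.
Context (m0 : nat) (t : schema m0) (I J : Type) (F : set_system J).
Context (FU : UltraFilter F) (A : J -> algebra t I).

Definition ultra_eq : rel {classic forall j, A j} :=
  fun x y => `[< F [set j | x j = y j] >].

Lemma ultra_eq_refl : reflexive ultra_eq.
Proof. by move=> x; apply/asboolP; apply: filterS filterT => j _. Qed.

Lemma ultra_eq_sym : symmetric ultra_eq.
Proof.
by move=> x y; apply/asboolP/asboolP; apply: filterS => j /= ->.
Qed.

Lemma ultra_eq_trans : transitive ultra_eq.
Proof.
move=> y x z /asboolP xy /asboolP yz; apply/asboolP.
by apply: filterS2 xy yz => j /= -> ->.
Qed.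

Definition ultra_equiv : equiv_rel {classic forall j, A j} :=
  EquivRel ultra_eq ultra_eq_refl ultra_eq_sym ultra_eq_trans.

Definition ultraproduct : algebra t I :=
  @Algebra m0 t I {eq_quot ultra_equiv}%qT (fun f k args =>
    (\pi_{eq_quot ultra_equiv}
       (fun j => op (A j) f k (fun i => repr (args i) j)))%qT).

End Ultraproduct.

Definition Up_class m0 (t : schema m0) I (L : alg_class t I) :
    alg_class t I := fun B =>
  exists (J : Type) (F : set_system J) (FU : UltraFilter F)
                  (A : J -> algebra t I),
     (forall j, L (A j)) /\ isomorphic B (ultraproduct FU A).

Definition reduct m0 (t : schema m0) I J (r : I -> J) (A : algebra t J) :
    algebra t I :=
  @Algebra m0 t I A (fun f k args => op A f (r \o k) args).

Definition dimension_set m0 (t : schema m0) I (A : algebra t I) (x : A) :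
  set I := [set i | cyl i x <> x].

Definition neat_set m0 (t : schema m0) (a b : wotype) (s : segment a b)
    (B : algebra t b) : set (reduct s B) :=
  [set x : B | dimension_set x `<=` range s].

Definition neat_closed m0 (t : schema m0)
    (K : forall n : wotype, alg_class t n) : Prop :=
  forall b, ord_le (fin_ord m0) b ->
  forall (a : wotype) (s : segment a b), proper_segment s ->
  forall B : algebra t b, K b B -> op_closed (@neat_set m0 t a b s B).

Definition neat_reduct m0 (t : schema m0) (a b : wotype) (s : segment a b)
    (B : algebra t b) (BP : op_closed (@neat_set m0 t a b s B)) :
  algebra t a := subalg BP.

Definition Nr_class m0 (t : schema m0) (a b : wotype) (s : segment a b)
    (L : alg_class t b) : alg_class t a := fun A =>
  exists (B : algebra t b) (BP : op_closed (@neat_set m0 t a b s B)),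
     L B /\ A = neat_reduct BP.

(* Main.v *)
Require Import Defs.
From mathcomp Require Import all_boot.
From mathcomp Require Import boolp classical_sets wochoice filter.

(** The algebra [A] itself is a subalgebra of a neat reduct of some [B] in
    [K (a + omega)]; the ultraproduct in the conclusion can be taken over a
    one-element index set ([Up_class_sub]).

    The separation hypothesis can be iterated: after finding an endomorphism
    [h] over the indices in a finite list [G] whose values are fixed by a new
    cylindrification [c_k], apply it again to [k :: G] and to the pair
    [h x <> h y].  Since the next endomorphism commutes with [c_k], the values
    of the composite are fixed by both new cylindrifications
    ([separating_blur]).  So every pair [x <> y] is separated by a map
    [g : A -> A] respecting the operations with indices in [G], whose values
    are fixed by arbitrarily many pairwise distinct cylindrifications
    [c_{k_0}, c_{k_1}, ...] with [k_i] outside [G].  Such a triple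
    [(G, k, g)] is called a blur.

    A blur turns [A] into an algebra with indices in [a + omega]: the indices
    of [a] keep their meaning, and [omega + i] is read as [k_i].  It is a
    reduct of [A] along a non-injective map of indices, hence need not belong
    to [K (a + omega)].  But any two indices are sent to different ones once
    [G] and the number of the [k_i] are large, and an axiom mentions only
    finitely many indices; so the reduced product [B] of these reducts over
    all blurs, modulo the filter of large [G] and long [k], satisfies all
    axioms ([variety_reduced_product]).  The map sending [x] to the class of
    [g x], with [g] ranging over all blurs, is then a homomorphism, is
    injective because blurs separate points, and has values of dimension set
    inside [a] because [c_{k_i}] fixes the values of [g].  A reduced product
    over all blurs at once replaces a product over the pairs [x <> y] followed
    by an ultraproduct over the finite sets of indices. *)

Set Implicit Arguments.
Unset Strict Implicit.
Unset Printing Implicit Defensive.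

(** * Equations in reducts *)

Section Reducts.
Context (m0 : nat) (t : schema m0).

Lemma eval_reduct I J (r : I -> J) (A : algebra t J) (v : nat -> A)
    (s : term t I) :
  @eval m0 t I (reduct r A) v s = eval v (term_map r s).
Proof.
elim: s => [//|f k args IH] /=; congr (op A f _ _).
by apply/funext => i; exact: IH.
Qed.

Lemma holds_reduct I J (r : I -> J) (A : algebra t J) (e : equation t I) :
  holds (reduct r A) e <-> holds A (equation_map r e).
Proof.
by split=> He v; have := He v; rewrite /equation_map /= !eval_reduct.
Qed.

Lemma term_map_comp I J L (q : J -> L) (r : I -> J) (s : term t I) :
  term_map q (term_map r s) = term_map (q \o r) s.
Proof.
elim: s => [//|f k args IH] /=; congr (App _ _).
by apply/funext => i; exact: IH.
Qed.

Lemma equation_map_comp I J L (q : J -> L) (r : I -> J) (e : equation t I) :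
  equation_map q (equation_map r e) = equation_map (q \o r) e.
Proof. by rewrite /equation_map /= !term_map_comp. Qed.

End Reducts.

(** * Reduced products *)

Section ReducedProduct.
Local Open Scope classical_set_scope.
Local Open Scope quotient_scope.
Context (m0 : nat) (t : schema m0) (I J : Type) (F : set_system J).
Context (FF : Filter F) (A : J -> algebra t I).

Definition reduced_eq : rel {classic forall j, A j} :=
  fun x y => `[< F [set j | x j = y j] >].

Lemma reduced_eq_refl : reflexive reduced_eq.
Proof. by move=> x; apply/asboolP; apply: filterS filterT => j _. Qed.

Lemma reduced_eq_sym : symmetric reduced_eq.
Proof. by move=> x y; apply/asboolP/asboolP; apply: filterS => j /= ->. Qed.

Lemma reduced_eq_trans : transitive reduced_eq.
Proof.
move=> y x z /asboolP xy /asboolP yz; apply/asboolP.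
by apply: filterS2 xy yz => j /= -> ->.
Qed.

Definition reduced_equiv : equiv_rel {classic forall j, A j} :=
  EquivRel reduced_eq reduced_eq_refl reduced_eq_sym reduced_eq_trans.

Definition reduced_product : algebra t I :=
  @Algebra m0 t I {eq_quot reduced_equiv} (fun f k args =>
    \pi_{eq_quot reduced_equiv}
      (fun j => op (A j) f k (fun i => repr (args i) j))).

Definition reduced_class (x : forall j, A j) : reduced_product :=
  \pi_{eq_quot reduced_equiv} x.

Definition representative (x : reduced_product) : forall j, A j :=
  @repr _ {eq_quot reduced_equiv} x.

Lemma representativeK (x : reduced_product) :
  reduced_class (representative x) = x.
Proof. exact: (@reprK _ {eq_quot reduced_equiv}). Qed.

Lemma reduced_classP (x y : forall j, A j) :
  reduced_class x = reduced_class y <-> F [set j | x j = y j].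
Proof.
split=> [/eqmodP/asboolP //|Fxy].
exact/eqmodP/asboolP.
Qed.

(** Operations have finite arity, so the sets of the filter on which the chosen
    representatives of the arguments agree with the given ones can be
    intersected. *)
Lemma op_reduced_class (f : t) (k : 'I_(delta f) -> I)
    (args : 'I_(rho f) -> forall j, A j) :
  op reduced_product f k (reduced_class \o args) =
  reduced_class (fun j => op (A j) f k (args^~ j)).
Proof.
apply/reduced_classP.
have Fargs i : F [set j | representative (reduced_class (args i)) j = args i j].
  exact/reduced_classP/representativeK.
apply: filterS (filter_forall _ Fargs) => j argsj.
by congr (op (A j) f k _); apply/funext => i; exact: argsj.
Qed.

Lemma eval_reduced_class (v : nat -> forall j, A j) (s : term t I) :
  @eval m0 t I reduced_product (reduced_class \o v) s =
  reduced_class (fun j => eval (v^~ j) s).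
Proof.
elim: s => [//|f k args IH] /=.
by rewrite -op_reduced_class; congr (op reduced_product f k _);
  apply/funext => i; exact: IH.
Qed.

Lemma holds_reduced_product (e : equation t I) :
  F [set j | holds (A j) e] -> holds reduced_product e.
Proof.
move=> Fe v.
have -> : v = reduced_class \o (representative \o v).
  by apply/funext => n /=; rewrite representativeK.
rewrite !eval_reduced_class; apply/reduced_classP.
by apply: filterS Fe => j; exact.
Qed.

End ReducedProduct.

(** * Embeddings and class operators *)

Section ClassOperators.
Local Open Scope classical_set_scope.
Context (m0 : nat) (t : schema m0).

Lemma injective_surjective_bijective (U V : Type) (h : U -> V) :
  injective h -> (forall y, exists x, h x = y) -> bijective h.
Proof.
move=> hI hS; have [g gK] := choice hS; exists g => [x|//].
by apply: hI; rewrite gK.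
Qed.

Lemma S_class_embedding I (L : alg_class t I) (A B : algebra t I) (h : A -> B) :
  L B -> is_hom h -> injective h -> S_class L A.
Proof.
move=> LB hH hI.
have hC : op_closed (range h).
  move=> f k args argsR.
  have ex_x i : exists x, h x = args i by have [x _ <-] := argsR i; exists x.
  have [x xP] := choice ex_x.
  exists (op A f k x) => //.
  rewrite hH; congr (op B f k _); by apply/funext => i; exact: xP.
exists B, (range h), hC; split=> //.
exists (fun x => exist (range h) (h x) (ex_intro2 _ _ x Logic.I erefl)).
  by move=> f k args; apply/eq_exist; exact: hH.
apply: injective_surjective_bijective => [x y [/hI]//|[y yP]].
by have [x _ xy] := yP; exists x; exact/eq_exist.
Qed.

(** Modulo a principal ultrafilter on one point, a class is determined by the
    value of any representative at that point. *)
Lemma Up_class_sub I (L : alg_class t I) (A : algebra t I) :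
  L A -> Up_class L A.
Proof.
move=> LA; exists unit, (principal_filter tt), (principal_filter_ultra tt).
exists (fun=> A); split=> //.
set U := ultraproduct _ _.
pose E := {eq_quot ultra_equiv (principal_filter_ultra tt) (fun=> A)}%qT.
pose cls (x : A) : U := (\pi_E (fun=> x))%qT.
pose val (y : U) : A := (@repr _ E y) tt.
have clsE (y : unit -> A) (z : U) : val z = y tt -> z = (\pi_E y)%qT.
  move=> zy; rewrite -[LHS](@reprK _ E); apply/eqmodP/asboolP.
  exact/principal_filterP.
have valK y : cls (val y) = y by apply/esym/clsE.
have clsK x : val (cls x) = x.
  have /eqmodP/asboolP/principal_filterP // :
    (\pi_E (@repr _ E (cls x)) = \pi_E (fun=> x))%qT.
  exact: reprK.
exists cls; last by exists val.
move=> f k args; apply/clsE; rewrite clsK.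
by congr (op A f k _); apply/funext => i; rewrite -[LHS]clsK.
Qed.

End ClassOperators.

(** * Systems of varieties and eventually injective index maps *)

Lemma ord_le_trans (a b c : wotype) : ord_le a b -> ord_le b c -> ord_le a c.
Proof.
move=> [r] [s]; constructor; exists (s \o r) => [x y|x y /= yx].
  by rewrite /= !seg_mono.
have [z yz] := seg_down yx.
by move: yx; rewrite yz seg_mono => /seg_down[w ->]; exists w.
Qed.

Lemma fin_ord_le_omega n : ord_le (fin_ord n) omega.
Proof.
constructor; exists (fun i : fin_ord n => nat_of_ord i) => // i j ji.
by exists (Ordinal (leq_ltn_trans ji (ltn_ord i))).
Qed.

Lemma omega_injection (a : wotype) :
  ord_le omega a -> exists f : nat -> a, injective f.
Proof.
move=> [s]; exists s => x y sxy; apply/eqP; rewrite eqn_leq.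
by rewrite -![(_ <= _)%N](seg_mono s) sxy !seg_mono /= leqnn.
Qed.

(** Only the values of [r] below [N] are kept; the later values of the new map
    are taken from a tail of [f] that avoids these finitely many points. *)
Lemma extend_injection (U : Type) (f r : nat -> U) N :
  injective f -> {in gtn N &, injective r} ->
  exists2 q : nat -> U, injective q & {in gtn N, q =1 r}.
Proof.
move=> fI rI.
have [M fM] : exists M, forall i n, i < N -> f (M + n) <> r i.
  elim: N {rI} => [|N [M fM]]; first by exists 0.
  have [[p fp]|no_p] := pselect (exists p, f p = r N).
    exists (M + p.+1) => i n; rewrite ltnS leq_eqVlt => /orP[/eqP->|iN].
      rewrite -fp => /fI Mpn.
      have : p < M + p.+1 + n by rewrite addnAC ltn_addl.
      by rewrite Mpn ltnn.
    by rewrite -addnA; exact: fM.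
  exists M => i n; rewrite ltnS leq_eqVlt => /orP[/eqP-> fMn|]; last exact: fM.
  by apply: no_p; exists (M + n).
exists (fun n => if n < N then r n else f (M + n)) => [x y|x]; last first.
  by rewrite inE => ->.
case: ltnP => xN; case: ltnP => yN.
- exact: rI.
- by move=> /esym/fM; case.
- by move=> /fM; case.
- by move=> /fI/addnI.
Qed.

Section Systems.
Local Open Scope classical_set_scope.
Context (m0 : nat) (t : schema m0) (K : forall n : wotype, alg_class t n).
Context (hK : complete_system K).

(** An axiom is an equation [e] over a finite [n], transported along some
    injection [r] from [omega] to [b].  Far along [F], the map [s j \o r] is
    injective on [n], although perhaps not on [omega]; hence it agrees on [n]
    with an injection from [omega] to [a], and [A] satisfies the transported
    [e]. *)
Lemma variety_reduced_product (a b : wotype) (A : algebra t a) (J : Type)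
    (F : set_system J) (FF : Filter F) (s : J -> b -> a) :
  ord_le omega a -> ord_le omega b -> K A ->
  (forall i i', i <> i' -> F [set j | s j i <> s j i']) ->
  K (reduced_product FF (fun j => reduct (s j) A)).
Proof.
have [_ [Sigma [_ _ Sigma_omega Kinf]]] := hK.
move=> a_inf b_inf /(Kinf _ a_inf) A_ax sP.
apply/(Kinf _ b_inf) => _ [e0 [r [e0P rI ->]]].
apply: holds_reduced_product.
have := e0P; rewrite Sigma_omega => -[n [u [_ [N uN] [e _ e0E]]]].
have ltN x : u x < N.
  rewrite ltnNge; apply/negP => Nu.
  by have [z zP] := seg_down (s := u) Nu; apply: uN; exists z.
have [f fI] := omega_injection a_inf.
have rF (p : 'I_N * 'I_N) :
    F [set j | p.1 <> p.2 -> s j (r p.1) <> s j (r p.2)].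
  have [->|ne] := eqVneq p.1 p.2.
    by apply: filterS filterT => j _ /(_ erefl).
  apply: filterS (sP (r p.1) (r p.2) _) => [j + _ //|/rI/val_inj].
  exact/eqP.
apply: filterS (filter_forall _ rF) => j sjP; apply/holds_reduct.
have [|q qI qE] := @extend_injection a f (s j \o r) N fI.
  move=> x y xN yN xy; apply: contrapT => ne.
  apply: (sjP (Ordinal xN, Ordinal yN)) xy => /=.
  by move/(congr1 val).
have -> : equation_map (s j) (equation_map r e0) = equation_map q e0.
  rewrite e0E !equation_map_comp; congr (equation_map _ e).
  by apply/funext => x /=; rewrite qE ?inE.
by apply: A_ax; exists e0, q.
Qed.

End Systems.

(** * Blurs *)

Section Blurs.
Local Open Scope classical_set_scope.
Context (m0 : nat) (t : schema m0) (I : Type) (A : algebra t I).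

(** The homomorphisms of the reduct to the indices in [G], without renumbering
    these indices. *)
Definition hom_on (G : seq {classic I}) (g : A -> A) : Prop :=
  forall (f : t) (k : 'I_(delta f) -> I) (args : 'I_(rho f) -> A),
    (forall i, (k i : {classic I}) \in G) ->
    g (op A f k args) = op A f k (g \o args).

Record blur := Blur {
  indices : seq {classic I};
  fresh : seq {classic I};
  blur_fun :> A -> A;
  fresh_uniq : uniq fresh;
  fresh_new : forall k, k \in fresh -> k \notin indices;
  blur_hom : hom_on indices blur_fun;
  blur_cyl : forall k x, k \in fresh -> cyl (k : I) (blur_fun x) = blur_fun x
}.

Definition large_blurs : set_system blur :=
  [set S | exists (G : seq {classic I}) (m : nat), forall j : blur,
     {subset G <= indices j} -> m <= size (fresh j) -> S j].

Lemma large_blurs_filter : Filter large_blurs.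
Proof.
split.
- by exists [::], 0.
- move=> S S' [G [m GmS]] [G' [m' GmS']]; exists (G ++ G'), (maxn m m') => j.
  move=> sG; rewrite geq_max => /andP[mj m'j]; split.
    by apply: GmS => // i iG; apply: sG; rewrite mem_cat iG.
  by apply: GmS' => // i iG; apply: sG; rewrite mem_cat iG orbT.
- move=> S S' SS' [G [m GmS]]; exists G, m => j Gj mj.
  exact/SS'/GmS.
Qed.

Lemma large_blurs_indices (i : {classic I}) :
  large_blurs [set j | i \in indices j].
Proof.
by exists [:: i], 0 => j Gj _; apply: Gj; rewrite mem_head.
Qed.

Lemma large_blurs_fresh n : large_blurs [set j | n < size (fresh j)].
Proof. by exists [::], n.+1. Qed.

Hypothesis separating : forall (n : nat) (r : 'I_n -> I), injective r ->
  forall x y : A, x <> y ->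
  exists (h : A -> A) (k : I),
    [/\ @is_hom m0 t 'I_n (reduct r A) (reduct r A) h,
        ~ range r k,
        @cyl m0 t I A k \o h = h
      & h x <> h y].

(** The hypothesis on injections from finite ordinals, restated for the set of
    entries of a list: this form can be iterated by consing the new index. *)
Lemma separating_endomorphism (G : seq {classic I}) (x y : A) : x <> y ->
  exists (h : A -> A) (k : {classic I}),
    [/\ hom_on G h, k \notin G, forall z, cyl (k : I) (h z) = h z
      & h x <> h y].
Proof.
move=> xy.
pose r (i : 'I_(size (undup G))) : I := tnth (in_tuple (undup G)) i.
have rI : injective r.
  by apply/(tuple_uniqP (in_tuple (undup G))); exact: undup_uniq.
have rP (i : {classic I}) : i \in G -> exists j, r j = i.
  rewrite -mem_undup => iG.
  by have /tnthP[j ->] : i \in in_tuple (undup G) by []; exists j.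
have [h [k [hH kr hk hxy]]] := separating rI xy.
exists h, k; split=> //.
- move=> f k' args k'G.
  have k'r i : exists j, r j = k' i by exact: rP.
  have [l lP] := choice k'r.
  have <- : r \o l = k' by exact/funext.
  exact: hH.
- by apply/negP => /rP[j jk]; apply: kr; exists j.
- by move=> z; rewrite -{2}hk.
Qed.

(** The endomorphism [h] for [G] and [k] is followed by a blur [g] whose indices
    include [k :: G] and which separates [h x] from [h y].  As [g] respects
    [c_k], the values of [g \o h] are fixed by [c_k] as well as by the
    cylindrifications that fix the values of [g]. *)
Lemma separating_blur (G : seq {classic I}) m (x y : A) : x <> y ->
  exists j : blur,
    [/\ {subset G <= indices j}, m <= size (fresh j) & j x <> j y].
Proof.
elim: m G x y => [|m IH] G x y xy.
  exists (@Blur G [::] id isT (fun k => ltac:(done)) (fun _ _ _ _ => erefl)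
    (fun k z => ltac:(done))).
  by split.
have [h [k [hH kG hk hxy]]] := separating_endomorphism G xy.
have [[G' ks g ksU ksN gH gk] /= [GG' szks gxy]] := IH (k :: G) _ _ hxy.
have kG' : k \in G' by apply: GG'; rewrite mem_head.
have jU : uniq (k :: ks).
  by rewrite /= ksU andbT; apply: contraL kG' => /ksN.
have jN i : i \in k :: ks -> i \notin G.
  rewrite inE => /predU1P[-> //|/ksN]; apply: contra => iG.
  by apply: GG'; rewrite inE iG orbT.
have jH : hom_on G (g \o h).
  move=> f l args lG /=; rewrite hH // gH // => i.
  by apply: GG'; rewrite inE lG orbT.
have jk i z : i \in k :: ks -> cyl (i : I) ((g \o h) z) = (g \o h) z.
  rewrite inE => /predU1P[->|/gk -> //] /=.
  (* [k] is one of the indices respected by [g], so [g] commutes with [c_k] *)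
  rewrite -{2}hk; apply/esym; rewrite {1}/cyl gH //.
by exists (Blur jU jN jH jk); split.
Qed.

End Blurs.

Section NeatEmbedding.
Local Open Scope classical_set_scope.
Context (m0 : nat) (t : schema m0) (a : wotype) (A : algebra t a) (d : a).
Local Existing Instance large_blurs_filter.

(** The default value [d] is used only for the indices [inr n] with [n] beyond
    the fresh indices of [j]; each fixed [n] is below their number for all
    large [j]. *)
Definition blur_index (j : blur A) (i : ord_add a omega) : a :=
  match i with inl i => i | inr n => nth d (fresh j) n end.

Definition blur_reduct (j : blur A) : algebra t (ord_add a omega) :=
  reduct (blur_index j) A.

Definition blur_product : algebra t (ord_add a omega) :=
  reduced_product (large_blurs_filter A) blur_reduct.

Definition blur_class (x : A) : blur_product :=
  reduced_class (large_blurs_filter A) (A := blur_reduct) (fun j => j x).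

(** Distinct indices of [a] are never identified; the two other cases use that
    fresh indices are pairwise distinct and outside [indices j]. *)
Lemma blur_index_separates (i i' : ord_add a omega) : i <> i' ->
  large_blurs [set j : blur A | blur_index j i <> blur_index j i'].
Proof.
have inlr (i0 : a) n :
    large_blurs [set j : blur A | i0 <> nth d (fresh j) n].
  apply: filterS2 (large_blurs_indices A i0) (large_blurs_fresh A n) => j.
  move=> /= i0j nj i0E; have := fresh_new (@mem_nth {classic a} d _ _ nj).
  by rewrite -i0E i0j.
case: i i' => [i|n] [i'|n'] ne /=.
- by apply: filterS filterT => j _ ii'; apply: ne; rewrite ii'.
- exact: inlr.
- by apply: filterS (inlr i' n) => j /= h /esym.
- apply: filterS2 (large_blurs_fresh A n) (large_blurs_fresh A n') => j.
  move=> /= nj n'j nn'; apply: ne; congr inr; apply/eqP.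
  by rewrite -(@nth_uniq {classic a} d _ _ _ nj n'j (fresh_uniq j)) nn'.
Qed.

Lemma blur_class_hom :
  @is_hom m0 t a A (reduct (add_seg a omega) blur_product) blur_class.
Proof.
move=> f k args.
apply/esym.
apply: etrans (op_reduced_class (A := blur_reduct) (large_blurs_filter A)
  (@inl a omega \o k) (fun i (j : blur A) => j (args i))) _.
apply/esym/reduced_classP.
have kF i := large_blurs_indices A (k i).
apply: filterS (filter_forall _ kF) => j kj.
exact: (@blur_hom _ _ _ _ j f k args kj).
Qed.

Lemma blur_class_neat x :
  @neat_set m0 t a _ (add_seg a omega) blur_product (blur_class x).
Proof.
case=> [i _|n nP]; first by exists i.
case: nP; rewrite /cyl /blur_class.
apply: etrans (op_reduced_class (A := blur_reduct) (large_blurs_filter A)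
  (fun=> inr n) (fun _ (j : blur A) => j x)) _.
apply/reduced_classP; apply: filterS (large_blurs_fresh A n) => j /= nj.
apply: blur_cyl; exact: (@mem_nth {classic a}).
Qed.

End NeatEmbedding.

Theorem theorem4 (m0 : nat) (hm0 : 2 <= m0) (t : schema m0)
  (K : forall n : wotype, alg_class t n)
  (hK : complete_system K) (hNr : neat_closed K)
  (a : wotype) (ha : ord_le omega a) (A : algebra t a) (hA : K a A)
  (hsep : forall (n : nat) (r : 'I_n -> a), injective r ->
     forall x y : A, x <> y ->
     exists (h : A -> A) (k : a),
       [/\ @is_hom m0 t 'I_n (reduct r A) (reduct r A) h,
           ~ range r k,
           @cyl m0 t a A k \o h = h
         & h x <> h y]) :
  Up_class (S_class (Nr_class (add_seg a omega) (K (ord_add a omega)))) A.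
Proof.
apply: Up_class_sub.
have [f _] := omega_injection ha; pose d := f 0.
have hao : ord_le omega (ord_add a omega).
  by apply: ord_le_trans ha _; constructor; exact: add_seg.
have KB : K _ (blur_product A d).
  exact: (variety_reduced_product hK (large_blurs_filter A) ha hao hA
    (@blur_index_separates _ _ _ _ d)).
have neatB :
  op_closed (@neat_set m0 t a _ (add_seg a omega) (blur_product A d)).
  apply: hNr KB; first exact: ord_le_trans (fin_ord_le_omega m0) hao.
  by exists (inr 0); case.
pose e (x : A) : neat_reduct neatB :=
  exist _ (blur_class d x) (@blur_class_neat _ _ _ _ d x).
apply: (S_class_embedding (h := e)).
- by exists (blur_product A d), neatB.
- by move=> g k args; apply/eq_exist; exact: blur_class_hom.
- move=> x y /(congr1 sval)/reduced_classP [G [m GmP]]; apply: contrapT => xy.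
  have [j [Gj mj]] := separating_blur hsep G m xy.
  by case; exact: GmP.
Qed.
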